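(* Let $\mathcal A$ and $\mathcal B$ be two commutative Fréchet algebras. Then $$C_{\mathrm{BSE}}(\Delta(\mathcal A\oplus\mathcal B))=C_{\mathrm{BSE}}(\Delta(\mathcal A))\times C_{\mathrm{BSE}}(\Delta(\mathcal B)),$$ where a pair $(\sigma_1,\sigma_2)$ of functions $\sigma_1:\Delta(\mathcal A)\to\mathbb C$ and $\sigma_2:\Delta(\mathcal B)\to\mathbb C$ is identified with the function $\sigma$ on $\Delta(\mathcal A\oplus\mathcal B)$ given by $\sigma(\varphi,0)=\sigma_1(\varphi)$ for $\varphi\in\Delta(\mathcal A)$ and $\sigma(0,\psi)=\sigma_2(\psi)$ for $\psi\in\Delta(\mathcal B)$.
   Context: A Fréchet algebra is a complete metrizable (Hausdorff) topological algebra over $\mathbb C$ whose topology is generated by a countable increasing family of submultiplicative seminorms. For a commutative Fréchet algebra $\mathcal C$, $\mathcal C^*$ is its topological dual, and $\Delta(\mathcal C)\subseteq\mathcal C^*$ is the set of all nonzero continuous multiplicative linear functionals $\mathcal C\to\mathbb C$, with the Gelfand topology (topology of pointwise convergence on $\mathcal C$). BSE-functions: for a bounded set $M\subseteq\mathcal C$ and $f\in\mathcal C^*$, put $P_M(f)=\sup_{a\in M}|f(a)|$. A bounded continuous function $\sigma:\Delta(\mathcal C)\to\mathbb C$ is a BSE-function if there exist a bounded set $M\subseteq\mathcal C$ and a real number $\beta_M>0$ such that for all $n$, all $c_1,\dots,c_n\in\mathbb C$ and all $\varphi_1,\dots,\varphi_n\in\Delta(\mathcal C)$, $\left|\sum_{i=1}^n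 c_i\sigma(\varphi_i)\right|\le\beta_M P_M\left(\sum_{i=1}^n c_i\varphi_i\right)$. The set of all BSE-functions is $C_{\mathrm{BSE}}(\Delta(\mathcal C))$. Direct sum: if the topologies of $\mathcal A,\mathcal B$ are given by increasing submultiplicative seminorms $(r_\ell)_{\ell\in\mathbb N}$, $(s_\ell)_{\ell\in\mathbb N}$, then $\mathcal A\oplus\mathcal B=\mathcal A\times\mathcal B$ with coordinatewise linear operations and multiplication, and seminorms $P_\ell(a,b)=r_\ell(a)+s_\ell(b)$; this is a commutative Fréchet algebra. One has $(\mathcal A\oplus\mathcal B)^*=\mathcal A^*\oplus\mathcal B^*$ via $(f,g)(a,b)=f(a)+g(b)$, and with this notation $\Delta(\mathcal A\oplus\mathcal B)=(\Delta(\mathcal A)\times\{0\})\cup(\{0\}\times\Delta(\mathcal B))$. *)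

(* Defs.v *)
From HB Require Import structures.
From mathcomp Require Import all_boot all_order all_algebra.
From mathcomp Require Import complex.
From mathcomp Require Import all_classical all_reals all_analysis.

Set Implicit Arguments.
Unset Strict Implicit.
Unset Printing Implicit Defensive.

Import Order.TTheory GRing.Theory Num.Theory.
Import numFieldNormedType.Exports.
Import ComplexField.Normc.

Local Open Scope classical_set_scope.
Local Open Scope ring_scope.

Section Seminorms.
Context (R : realType) (E : tvsType R[i]).

Definition seminorm (p : E -> R) :=
  [/\ forall x, 0 <= p x,
      forall x y, p (x + y) <= p x + p y &
      forall (c : R[i]) x, p (c *: x) = normc c * p x].

Definition submultiplicative (mul : E -> E -> E) (p : E -> R) :=
  forall x y, p (mul x y) <= p x * p y.

(* The p l generate the uniform structure of E, hence its topology (see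
   [generates_nbhsP]); stating it on entourages is needed because [tvsType] does
   not relate the uniform structure to the addition. For an increasing family,
   the balls of the single p l form a base. *)
Definition generates (p : nat -> E -> R) :=
  forall V : set (E * E), entourage V <->
    exists (l : nat) (e : R),
      0 < e /\ [set xy | p l (xy.2 - xy.1) < e] `<=` V.

Definition frechet_seminorms (mul : E -> E -> E) (p : nat -> E -> R) :=
  [/\ forall l, seminorm (p l),
      forall l, submultiplicative mul (p l),
      forall l x, p l x <= p l.+1 x &
      generates p].

Lemma generates_nbhsP (p : nat -> E -> R) : generates p ->
  forall (x : E) (U : set E), nbhs x U <->
    exists (l : nat) (e : R), 0 < e /\ [set y | p l (y - x) < e] `<=` U.
Proof.
move=> pE x U; rewrite -nbhs_entourageE; split.
  move=> [V /pE[l [e [e0 pV]]] VU]; exists l, e; split=> // y /= pxy.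
  by apply: VU; apply/xsectionP; exact: pV.
move=> [l [e [e0 pU]]].
exists [set xy | p l (xy.2 - xy.1) < e]; last first.
  by move=> y /xsectionP pxy; exact: pU.
by apply/pE; exists l, e; split.
Qed.

End Seminorms.

(* No unit is assumed, hence a bare product rather than a ring structure. *)
HB.mixin Record Tvs_isComFrechetAlgebra (R : realType) E & Tvs R[i] E := {
  fmul : E -> E -> E ;
  fmulA : associative fmul ;
  fmulC : commutative fmul ;
  fmulDl : left_distributive fmul +%R ;
  fmulZl : forall (c : R[i]) x y, fmul (c *: x) y = c *: fmul x y ;
  frechet_hausdorff : hausdorff_space E ;
  frechet_complete : forall F : set_system E,
    ProperFilter F -> cauchy F -> exists x : E, F --> x ;
  frechet_topology : exists p : nat -> E -> R, frechet_seminorms fmul p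
}.

#[short(type="comFrechetAlgType")]
HB.structure Definition ComFrechetAlgebra (R : realType) :=
  {E of Tvs R[i] E & Tvs_isComFrechetAlgebra R E}.

Section DirectSum.
Context (R : realType) (A B : comFrechetAlgType R).

Definition dsum_mul (x y : A * B) : A * B := (fmul x.1 y.1, fmul x.2 y.2).

Definition dsum_seminorm (r : nat -> A -> R) (s : nat -> B -> R)
  (l : nat) (x : A * B) : R := r l x.1 + s l x.2.

Lemma dsum_frechet_seminorms (r : nat -> A -> R) (s : nat -> B -> R) :
  frechet_seminorms fmul r -> frechet_seminorms fmul s ->
  frechet_seminorms dsum_mul (dsum_seminorm r s).
Proof.
move=> [rS rM rI rG] [sS sM sI sG].
have rI' m n x : (m <= n)%N -> r m x <= r n x.
  by move=> mn; apply: (homo_leq lexx le_trans (f := r^~ x)) => // k; exact: rI.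
have sI' m n x : (m <= n)%N -> s m x <= s n x.
  by move=> mn; apply: (homo_leq lexx le_trans (f := s^~ x)) => // k; exact: sI.
have r0 l x : 0 <= r l x by have [] := rS l.
have s0 l x : 0 <= s l x by have [] := sS l.
split.
- move=> l; have [_ rD rZ] := rS l; have [_ sD sZ] := sS l.
  rewrite /dsum_seminorm; split.
  + by move=> x; rewrite addr_ge0.
  + by move=> x y /=; rewrite addrACA lerD.
  + by move=> c x /=; rewrite rZ sZ mulrDr.
- move=> l x y; rewrite /dsum_seminorm /=.
  apply: (le_trans (lerD (rM _ _ _) (sM _ _ _))).
  rewrite mulrDl !mulrDr -addrA lerD2l addrA lerDr.
  by rewrite addr_ge0// mulr_ge0.
- by move=> l x; rewrite lerD.
- move=> V; split.
  + move=> [[V1 V2] /= [/rG[l1 [e1 [e10 H1]]] /sG[l2 [e2 [e20 H2]]]] V12].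
    exists (maxn l1 l2), (Num.min e1 e2); split; first by rewrite lt_min e10.
    move=> [[x1 x2] [y1 y2]]; rewrite /dsum_seminorm /= lt_min => /andP[h1 h2].
    have /V12 : (V1 `*` V2) ((x1, y1), (x2, y2)).
      split => /=; [apply: H1|apply: H2] => /=.
        apply: le_lt_trans h1; apply: (le_trans (rI' _ _ _ (leq_maxl l1 l2))).
        by rewrite lerDl.
      apply: le_lt_trans h2; apply: (le_trans (sI' _ _ _ (leq_maxr l1 l2))).
      by rewrite lerDr.
    by move=> [[[? ?] [? ?]] /= VV [<- <- <- <-]].
  + move=> [l [e [e0 HV]]].
    have e20 : 0 < e / 2 by rewrite divr_gt0.
    exists ([set xy | r l (xy.2 - xy.1) < e / 2],
            [set xy | s l (xy.2 - xy.1) < e / 2]).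
      by split; [apply/rG|apply/sG]; exists l, (e / 2); split.
    move=> [[x1 y1] [x2 y2]] /= [h1 h2].
    exists ((x1, x2), (y1, y2)) => //=; apply: HV => /=.
    by rewrite /dsum_seminorm /= (splitr e) ltrD.
Qed.

Fact dsum_mulA : associative dsum_mul.
Proof. by move=> x y z; rewrite /dsum_mul /= !fmulA. Qed.

Fact dsum_mulC : commutative dsum_mul.
Proof. by move=> x y; congr (_, _); exact: fmulC. Qed.

Fact dsum_mulDl : left_distributive dsum_mul +%R.
Proof. by move=> x y z; congr (_, _); exact: fmulDl. Qed.

Fact dsum_mulZl (c : R[i]) (x y : A * B) :
  dsum_mul (c *: x) y = c *: dsum_mul x y.
Proof. by congr (_, _); exact: fmulZl. Qed.

Fact dsum_hausdorff : hausdorff_space (A * B)%type.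
Proof.
move=> [a b] [a' b'] h; congr (_, _).
  apply: (@frechet_hausdorff R A) => U V Ua Va'.
  have [||[x y] [/= Ux Vx]] := h (U `*` setT) (V `*` setT).
  - by exists (U, setT) => //; split => //=; exact: filterT.
  - by exists (V, setT) => //; split => //=; exact: filterT.
  - by exists x; split; [case: Ux|case: Vx].
apply: (@frechet_hausdorff R B) => U V Ua Va'.
have [||[x y] [/= Ux Vx]] := h (setT `*` U) (setT `*` V).
- by exists (setT, U) => //; split => //=; exact: filterT.
- by exists (setT, V) => //; split => //=; exact: filterT.
- by exists y; split; [case: Ux|case: Vx].
Qed.

Fact dsum_complete (F : set_system (A * B)) :
  ProperFilter F -> cauchy F -> exists x : A * B, F --> x.
Proof.
move=> FF cF.
have [|a Fa] := @frechet_complete R A (fst @ F) _.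
  move=> V entV.
  have : entourage [set xy : (A * B) * (A * B) | V (xy.1.1, xy.2.1)].
    exists (V, setT); first by split=> //=; exact: entourageT.
    by move=> [[x1 y1] [x2 y2]] /= [Vx _]; exists ((x1, x2), (y1, y2)).
  move=> /cF[[P Q] /= [FP FQ] PQ].
  exists (fst @` P, fst @` Q).
    by split; [apply: filterS FP|apply: filterS FQ] => x Px; exists x.
  by move=> [x y] /= [[p Pp <-] [q Qq <-]]; exact: (PQ (p, q)).
have [|b Fb] := @frechet_complete R B (snd @ F) _.
  move=> V entV.
  have : entourage [set xy : (A * B) * (A * B) | V (xy.1.2, xy.2.2)].
    exists (setT, V); first by split=> //=; exact: entourageT.
    by move=> [[x1 y1] [x2 y2]] /= [_ Vx]; exists ((x1, x2), (y1, y2)).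
  move=> /cF[[P Q] /= [FP FQ] PQ].
  exists (snd @` P, snd @` Q).
    by split; [apply: filterS FP|apply: filterS FQ] => x Px; exists x.
  by move=> [x y] /= [[p Pp <-] [q Qq <-]]; exact: (PQ (p, q)).
exists (a, b) => U [[U1 U2] /= [Ua Ub] U12].
have F1 : F (fst @^-1` U1) := Fa _ Ua.
have F2 : F (snd @^-1` U2) := Fb _ Ub.
by apply: filterS (filterI F1 F2) => x [x1 x2]; exact: U12.
Qed.

Fact dsum_topology :
  exists p : nat -> A * B -> R, frechet_seminorms dsum_mul p.
Proof.
have [r rP] := @frechet_topology R A; have [s sP] := @frechet_topology R B.
by exists (dsum_seminorm r s); exact: dsum_frechet_seminorms.
Qed.

HB.instance Definition _ := Tvs_isComFrechetAlgebra.Build R (A * B)%type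
  dsum_mulA dsum_mulC dsum_mulDl dsum_mulZl
  dsum_hausdorff dsum_complete dsum_topology.

End DirectSum.

Section Spectrum.
Context (R : realType) (A : comFrechetAlgType R).

(* The ambient type {ptws A -> R[i]^o} gives Delta A, seen as a type, the Gelfand
   topology. *)
Definition Delta : set {ptws A -> R[i]^o} :=
  [set phi | [/\ linear (phi : A -> R[i]^o),
                 continuous (phi : A -> R[i]^o),
                 forall x y : A, phi (fmul x y) = phi x * phi y &
                 exists x : A, phi x != 0]].

(* M is absorbed by every neighbourhood of 0. *)
Definition tvs_bounded (M : set A) :=
  forall U : set A, nbhs 0 U ->
    exists r : R, 0 < r /\
      forall c : R[i], r <= normc c -> M `<=` *:%R c @` U.

Lemma tvs_boundedP (p : nat -> A -> R) (M : set A) :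
  frechet_seminorms fmul p ->
  tvs_bounded M <->
    forall l, exists K : R, forall a, M a -> p l a <= K.
Proof.
move=> [pS _ _ pG]; split=> [bM l|bM U /(generates_nbhsP pG)[l [e [e0 pU]]]].
  have [_ _ pZ] := pS l.
  have [|r [r0 Mr]] := bM [set y | p l y < 1].
    by apply/(generates_nbhsP pG); exists l, 1; split=> // y /=; rewrite subr0.
  have nr : normc (r%:C)%C = r.
    by rewrite /normc /= expr0n /= addr0 sqrtr_sqr gtr0_norm.
  exists r => a /(Mr (r%:C)%C _)[|u /= /ltW pu <-]; first by rewrite nr.
  by rewrite pZ nr ler_piMr// ltW.
have [_ _ pZ] := pS l; have [K pK] := bM l.
have r0 : 0 < (`|K| + 1) / e by rewrite divr_gt0// ltr_wpDl.
exists ((`|K| + 1) / e); split=> // c rc a Ma.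
have nc0 : 0 < normc c by exact: lt_le_trans rc.
have c0 : c != 0 by apply: contraTneq nc0 => ->; rewrite normc0 ltxx.
exists (c^-1 *: a); last by rewrite scalerA divff// scale1r.
apply: pU; rewrite /= subr0 pZ normcV ltr_pdivrMl//.
move: rc; rewrite ler_pdivrMr//; apply: lt_le_trans.
by rewrite (le_lt_trans (pK _ Ma))// (le_lt_trans (ler_norm K))// ltrDl.
Qed.

(* [sup] is 0 on the empty set and on unbounded sets; the latter do not occur
   for M bounded and f continuous. *)
Definition dual_seminorm (M : set A) (f : A -> R[i]) : R :=
  sup [set normc (f a) | a in M].

Definition CBSE : set (Delta -> R[i]^o) :=
  [set sigma : Delta -> R[i]^o | [/\ bounded_fun sigma, continuous sigma &
    exists (M : set A) (beta : R), [/\ tvs_bounded M, 0 < beta &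
      forall (n : nat) (c : 'I_n -> R[i]) (phi : 'I_n -> Delta),
        normc (\sum_(i < n) c i * sigma (phi i)) <=
        beta * dual_seminorm M (fun a => \sum_(i < n) c i * \val (phi i) a)]]].

End Spectrum.

Arguments Delta {R} A _.
Arguments CBSE {R} A _.

Section SpectrumDirectSum.
Context (R : realType) (A B : comFrechetAlgType R).

Fact Delta_inl_subproof (phi : Delta A) :
  (fun x : A * B => \val phi x.1) \in Delta (A * B)%type.
Proof.
case: phi => phi /= /set_mem[linphi cphi mphi [x phix]]; apply/mem_set; split.
- by move=> c u v; exact: linphi.
- move=> u; apply: (@continuous_comp _ _ _ fst (phi : A -> R[i]^o)).
    exact: cvg_fst.
  exact: cphi.
- by move=> u v; exact: mphi.
- by exists (x, 0).
Qed.

Fact Delta_inr_subproof (psi : Delta B) :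
  (fun x : A * B => \val psi x.2) \in Delta (A * B)%type.
Proof.
case: psi => psi /= /set_mem[linpsi cpsi mpsi [x psix]]; apply/mem_set; split.
- by move=> c u v; exact: linpsi.
- move=> u; apply: (@continuous_comp _ _ _ snd (psi : B -> R[i]^o)).
    exact: cvg_snd.
  exact: cpsi.
- by move=> u v; exact: mpsi.
- by exists (0, x).
Qed.

(* (phi, 0) and (0, psi). *)
Definition Delta_inl (phi : Delta A) : Delta (A * B)%type :=
  SigSub (Delta_inl_subproof phi).

Definition Delta_inr (psi : Delta B) : Delta (A * B)%type :=
  SigSub (Delta_inr_subproof psi).

Lemma Delta_inl_inj : injective Delta_inl.
Proof.
move=> phi phi' /(congr1 val)/= h; apply: val_inj; apply/funext => a.
exact: (congr1 (fun f => f (a, 0)) h).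
Qed.

Lemma Delta_inr_inj : injective Delta_inr.
Proof.
move=> psi psi' /(congr1 val)/= h; apply: val_inj; apply/funext => b.
exact: (congr1 (fun f => f (0, b)) h).
Qed.

Lemma Delta_inl_inr (phi : Delta A) (psi : Delta B) :
  Delta_inl phi <> Delta_inr psi.
Proof.
move=> /(congr1 val)/= h; have [lpsi _ _ _] := set_valP psi.
have [_ _ _ [a]] := set_valP phi; apply/negP; rewrite negbK; apply/eqP.
transitivity (\val psi 0); first exact: (congr1 (fun f => f (a, 0)) h).
by have := lpsi (-1) 0 0; rewrite scaler0 addr0 scaleN1r addNr.
Qed.

Lemma Delta_dsumP (chi : Delta (A * B)%type) :
  (exists phi, chi = Delta_inl phi) \/ (exists psi, chi = Delta_inr psi).
Proof.
have [lchi cchi mchi [x chix]] := set_valP chi.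
set f : A * B -> R[i]^o := \val chi in lchi cchi mchi chix.
have f0 : f 0 = 0.
  by have := lchi (-1) 0 0; rewrite scaler0 addr0 scaleN1r addNr.
have fD u v : f (u + v) = f u + f v.
  by have := lchi 1 u v; rewrite !scale1r.
have fE u : f u = f (u.1, 0) + f (0, u.2).
  by rewrite -fD; congr f; case: u => a b; congr (_, _); rewrite /= ?addr0 ?add0r.
have mul0 (E : comFrechetAlgType R) (e : E) : fmul 0 e = 0.
  by rewrite -(scale0r (0 : E)) fmulZl !scale0r.
have f12 a b : f (a, 0) * f (0, b) = 0.
  by rewrite -mchi -f0; congr f; congr (_, _) => /=;
    [rewrite fmulC|]; exact: mul0.
have [[a fa]|h] := pselect (exists a, f (a, 0) != 0).
  left; have f2 b : f (0, b) = 0.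
    by have /eqP := f12 a b; rewrite mulf_eq0 (negPf fa) => /eqP.
  have phiP : (fun a => f (a, 0)) \in Delta A.
    apply/mem_set; split; last by exists a.
    + move=> c u v /=; rewrite -lchi; congr f.
      by congr (_, _); rewrite /= scaler0 addr0.
    + move=> u; apply: (@continuous_comp _ _ _ (fun a => (a, 0)) f).
        by apply: cvg_pair; [exact: cvg_id|exact: cvg_cst].
      exact: cchi.
    + move=> u v /=; rewrite -mchi; congr f.
      by congr (_, _); rewrite /= mul0.
  exists (SigSub phiP); apply: val_inj; apply/funext => u /=.
  by rewrite -/f fE f2 addr0.
right; have f1 a : f (a, 0) = 0.
  by apply/eqP; apply: contra_notT h => ?; exists a.
have psiP : (fun b => f (0, b)) \in Delta B.
  apply/mem_set; split.
  + move=> c u v /=; rewrite -lchi; congr f.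
    by congr (_, _); rewrite /= scaler0 addr0.
  + move=> u; apply: (@continuous_comp _ _ _ (fun b => (0, b)) f).
      by apply: cvg_pair; [exact: cvg_cst|exact: cvg_id].
    exact: cchi.
  + move=> u v /=; rewrite -mchi; congr f.
    by congr (_, _); rewrite /= mul0.
  + by exists x.2; move: chix; rewrite -/f fE f1 add0r.
exists (SigSub psiP); apply: val_inj; apply/funext => u /=.
by rewrite -/f fE f1 add0r.
Qed.

Fact Delta_dsum_case (chi : Delta (A * B)%type) :
  {phi | chi = Delta_inl phi} + {psi | chi = Delta_inr psi}.
Proof.
case: (pselect (exists phi, chi = Delta_inl phi)) => [/cid|h]; first by left.
by right; apply: cid; case: (Delta_dsumP chi).
Qed.

(* The function on Delta (A * B) identified with the pair s. *)
Definition dsum_fun (s : (Delta A -> R[i]^o) * (Delta B -> R[i]^o))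
    (chi : Delta (A * B)%type) : R[i]^o :=
  match Delta_dsum_case chi with
  | inl (exist phi _) => s.1 phi
  | inr (exist psi _) => s.2 psi
  end.

Lemma dsum_fun_inl s phi : dsum_fun s (Delta_inl phi) = s.1 phi.
Proof.
rewrite /dsum_fun; case: Delta_dsum_case => [[phi' /Delta_inl_inj-> //]|[psi]].
by move/Delta_inl_inr.
Qed.

Lemma dsum_fun_inr s psi : dsum_fun s (Delta_inr psi) = s.2 psi.
Proof.
rewrite /dsum_fun; case: Delta_dsum_case => [[phi]|[psi' /Delta_inr_inj-> //]].
by move/esym/Delta_inl_inr.
Qed.

Lemma dsum_fun_bij : bijective dsum_fun.
Proof.
exists (fun sigma => (sigma \o Delta_inl, sigma \o Delta_inr)).
  move=> [s1 s2]; congr (_, _); apply/funext => phi /=.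
    by rewrite dsum_fun_inl.
  by rewrite dsum_fun_inr.
move=> sigma; apply/funext => chi.
case: (Delta_dsumP chi) => [[phi ->]|[psi ->]].
  by rewrite dsum_fun_inl.
by rewrite dsum_fun_inr.
Qed.

End SpectrumDirectSum.

(* Main.v *)
(* A is a retract of A (+) B, and every character of the sum restricts to 0 on
   one of the summands. So BSE-functions pull back along Delta A -> Delta (A (+) B)
   (project the bounded set), and extend by 0 (embed the bounded set); characters
   that do not vanish on A form an open set, which gives continuity of the
   extension. Finally (s1, s2) is the sum of the extensions (s1, 0) and (0, s2),
   and BSE-functions are stable under addition, with the union of the bounded
   sets. *)
Require Import Defs.
From mathcomp Require Import all_boot all_order all_algebra.
From mathcomp Require Import complex.
From mathcomp Require Import all_classical all_reals all_analysis.

Import Order.TTheory GRing.Theory Num.Theory.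
Import numFieldNormedType.Exports.
Import ComplexField.Normc.

Local Open Scope classical_set_scope.
Local Open Scope ring_scope.

(* [ex_bound] needs a proper filter, which excludes an empty domain. *)
Lemma bounded_funP (T : Type) (K : numFieldType)
    (V : pseudoMetricNormedZmodType K) (f : T -> V) :
  bounded_fun f <-> exists M, forall x, `|f x| <= M.
Proof.
split=> [bf|[M fM]].
  have /filter_ex[M fM] : \forall M \near +oo, forall x, setT x -> `|f x| <= M.
    exact: bf.
  by exists M => x; exact: fM.
(* If [T] is empty, [M] is arbitrary and may fail to be real; [|M|] is always real. *)
have : \forall N \near +oo, `|M| <= N by exact: nbhs_pinfty_ge.
apply: filterS => N MN x _; apply: le_trans MN.
by rewrite ger0_norm ?fM// (le_trans _ (fM x)).
Qed.

(** * Characters on bounded sets, and sums of BSE-functions *)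

Section Spectrum.
Set Implicit Arguments.
Context (R : realType) (A : comFrechetAlgType R).

Lemma normc_ge0 (z : R[i]) : 0 <= normc z.
Proof. by case: z => x y; exact: sqrtr_ge0. Qed.

Lemma Delta_eval_continuous (a : A) :
  continuous (fun chi : Delta A => (\val chi a : R[i]^o)).
Proof.
move=> chi.
apply: (@continuous_comp _ _ _ (\val : Delta A -> {ptws A -> R[i]^o})
  (fun f : {ptws A -> R[i]^o} => f a)).
  exact: initial_continuous.
exact: (@proj_continuous A (fun=> (R[i]^o : topologicalType)) a).
Qed.

Lemma ptws_continuous (I T : topologicalType)
    (f : T -> {ptws I -> R[i]^o}) :
  (forall a, continuous (fun t => f t a : R[i]^o)) -> continuous f.
Proof. by move=> fc t; apply/pointwise_cvgP => a; exact: fc. Qed.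

Lemma Delta_continuous (T : topologicalType) (j : T -> Delta A) :
  (forall a, continuous (fun t => \val (j t) a : R[i]^o)) -> continuous j.
Proof. by move=> jc; apply: continuous_comp_initial; exact: ptws_continuous. Qed.

Lemma DeltaB (phi : Delta A) (x y : A) :
  \val phi (x - y) = \val phi x - \val phi y.
Proof.
have [lphi _ _ _] := set_valP phi.
by rewrite addrC -scaleN1r lphi scaleN1r addrC.
Qed.

(** The preimage of the open unit disc is a neighbourhood of 0; the scalar by which it absorbs [M]
    is the bound. *)
Lemma Delta_normc_bounded (M : set A) (phi : Delta A) : tvs_bounded M ->
  exists K, forall a, M a -> normc (\val phi a) <= K.
Proof.
move=> bM; have [lphi cphi _ _] := set_valP phi.
have phi0 : \val phi 0 = 0 by rewrite -(subrr 0) DeltaB subrr.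
have phiZ c x : \val phi (c *: x) = c * \val phi x.
  by have := lphi c x 0; rewrite !addr0 phi0 addr0.
have [|r [r0 Mr]] := bM [set a | `|\val phi a| < 1].
  have /cvgr0Pnorm_lt : \val phi a @[a --> 0] --> (0 : R[i]^o).
    by rewrite -[X in _ --> X]phi0; exact: cphi.
  by move=> /(_ 1 ltr01).
have nr : normc (r%:C)%C = r.
  by rewrite /normc /= expr0n /= addr0 sqrtr_sqr gtr0_norm.
exists r => a /(Mr (r%:C)%C _)[|u /= pu <-]; first by rewrite nr.
rewrite phiZ normcM nr ler_piMr ?(ltW r0)// ltW//.
by rewrite -ltcR.
Qed.

Lemma lincomb_normc_bounded (M : set A) (n : nat) (c : 'I_n -> R[i])
    (phi : 'I_n -> Delta A) : tvs_bounded M ->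
  exists K, forall a, M a -> normc (\sum_(i < n) c i * \val (phi i) a) <= K.
Proof.
move=> bM; elim: n => [|n IH] in c phi *.
  by exists 0 => a _; rewrite big_ord0 normc0.
have [K KP] := IH (c \o widen_ord (leqnSn n)) (phi \o widen_ord (leqnSn n)).
have [L LP] := Delta_normc_bounded (phi ord_max) bM.
exists (K + normc (c ord_max) * L) => a Ma; rewrite big_ord_recr.
apply: le_trans (le_normcD _ _) _; rewrite lerD ?KP//.
rewrite normcM ler_wpM2l ?normc_ge0 ?LP//.
Qed.

(** Boundedness of [N] makes the supremum over [N] a genuine one, not the default 0 of [sup] on
    unbounded sets. *)
Lemma le_dual_seminorm (M N : set A) (n : nat) (c : 'I_n -> R[i])
    (phi : 'I_n -> Delta A) : M `<=` N -> tvs_bounded N ->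
  dual_seminorm M (fun a => \sum_(i < n) c i * \val (phi i) a) <=
  dual_seminorm N (fun a => \sum_(i < n) c i * \val (phi i) a).
Proof.
move=> MN bN; have [K KP] := lincomb_normc_bounded c phi bN.
(* For empty [M] the left side is the default 0, so the right side only has to be nonnegative. *)
have [->|/set0P[a Ma]] := eqVneq M set0.
  rewrite /dual_seminorm image_set0 sup0.
  have [->|/set0P[a Na]] := eqVneq N set0; first by rewrite image_set0 sup0.
  apply: le_trans (normc_ge0 (\sum_(i < n) c i * \val (phi i) a)) _.
  by apply: ub_le_sup; [exists K => _ [x Nx <-]; exact: KP|exists a].
apply: ge_sup; first by exists (normc (\sum_(i < n) c i * \val (phi i) a)), a.
move=> _ [b Mb <-]; apply: ub_le_sup; last by exists b => //; exact: MN.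
by exists K => _ [x Nx <-]; exact: KP.
Qed.

Lemma tvs_boundedU (M N : set A) :
  tvs_bounded M -> tvs_bounded N -> tvs_bounded (M `|` N).
Proof.
move=> bM bN U U0; have [r [r0 rM]] := bM U U0; have [s [s0 sN]] := bN U U0.
exists (Num.max r s); split; first by rewrite lt_max r0.
by move=> c; rewrite ge_max => /andP[rc sc] a [/(rM _ rc)|/(sN _ sc)].
Qed.

Lemma CBSE_add (sigma tau : Delta A -> R[i]^o) :
  CBSE A sigma -> CBSE A tau -> CBSE A (fun chi => sigma chi + tau chi).
Proof.
move=> [bs cs [M [b [bM b0 sM]]]] [bt ct [N [d [bN d0 tN]]]]; split.
- move: bs bt => /bounded_funP[K KP] /bounded_funP[L LP]; apply/bounded_funP.
  by exists (K + L) => x; rewrite (le_trans (ler_normD _ _))// lerD ?KP ?LP.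
- by move=> x; apply: cvgD; [exact: nbhs_filter|exact: cs|exact: ct].
(* Both dual seminorms are at most the one of the union, so the constants add up. *)
exists (M `|` N), (b + d); split; [exact: tvs_boundedU|exact: addr_gt0|].
move=> n c phi; under eq_bigr do rewrite mulrDr.
rewrite big_split (le_trans (le_normcD _ _))// mulrDl.
have bMN := tvs_boundedU bM bN.
apply: lerD; [apply: le_trans (sM _ _ _) _|apply: le_trans (tN _ _ _) _];
  by rewrite ler_pM2l// le_dual_seminorm.
Qed.

End Spectrum.

Section Image.
Set Implicit Arguments.
Context (R : realType) (D E : comFrechetAlgType R).

(** Pull the neighbourhood back along [f]; homogeneity carries the absorption over with the same
    radius. *)
Lemma tvs_bounded_image (f : D -> E) (M : set D) :
  linear f -> continuous f -> tvs_bounded M -> tvs_bounded (f @` M).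
Proof.
move=> lf cf bM U U0.
have f0 : f 0 = 0 by have := lf (-1) 0 0; rewrite scaler0 addr0 scaleN1r addNr.
have fZ c x : f (c *: x) = c *: f x by have := lf c x 0; rewrite !addr0 f0 addr0.
have [|r [r0 rM]] := bM (f @^-1` U); first by apply: cf; rewrite f0.
exists r; split=> // c rc _ [x Mx <-]; have [y Uy <-] := rM _ rc _ Mx.
by exists (f y) => //; rewrite fZ.
Qed.

End Image.

(** * Restriction to a retract and extension by zero *)

Section Retract.
Set Implicit Arguments.
Context (R : realType) (D E : comFrechetAlgType R).
Context (iota : D -> E) (pr : E -> D).
Hypotheses (iota_lin : linear iota) (iota_cont : continuous iota).
Hypotheses (pr_lin : linear pr) (pr_cont : continuous pr).
Hypothesis iotaK : cancel iota pr.
Context (j : Delta D -> Delta E).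
Hypothesis jE : forall phi x, \val (j phi) x = \val phi (pr x).

Lemma CBSE_restrict (sigma : Delta E -> R[i]^o) :
  CBSE E sigma -> CBSE D (sigma \o j).
Proof.
move=> [bs cs [M [b [bM b0 sM]]]]; split.
- by move: bs => /bounded_funP[K KP]; apply/bounded_funP; exists K => x; exact: KP.
- move=> phi; apply: continuous_comp; last exact: cs.
  apply: Delta_continuous => a.
  have -> : (fun t => \val (j t) a) = (fun t : Delta D => \val t (pr a)).
    by apply/funext => t; exact: jE.
  exact: Delta_eval_continuous.
exists (pr @` M), b; split=> //; first exact: tvs_bounded_image.
move=> n c phi; apply: le_trans (sM n c (j \o phi)) _.
rewrite /dual_seminorm image_comp ler_pM2l//.
by under eq_fun do under eq_bigr do rewrite jE.
Qed.

Hypothesis range_jP :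
  forall chi, range j chi \/ forall x, \val chi (iota x) = 0.

(** The new family is chosen before [s] and [t], so that one choice serves both sides of the BSE
    inequality: the values of the functions and the evaluations at each point. Characters outside
    the range of [j] become a dummy [phi0] with coefficient 0. *)
Lemma lincomb_pullback (n : nat) (c : 'I_n -> R[i]) (chi : 'I_n -> Delta E) :
  exists (m : nat) (c' : 'I_m -> R[i]) (phi : 'I_m -> Delta D),
  forall (s : Delta D -> R[i]) (t : Delta E -> R[i]),
    (forall phi', t (j phi') = s phi') ->
    (forall chi', (forall x, \val chi' (iota x) = 0) -> t chi' = 0) ->
    \sum_(i < n) c i * t (chi i) = \sum_(i < m) c' i * s (phi i).
Proof.
(* Without a character on [D] there is no dummy; then every term vanishes and the empty family
   works. *)
have [[phi0 _]|noD] := pselect (exists _ : Delta D, True); last first.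
  exists 0%N, (fun=> 0), (fun i : 'I_0 => False_rect _ (notF (ltn_ord i))).
  move=> s t _ t0; rewrite big_ord0 big1// => i _.
  case: (range_jP (chi i)) => [[phi _ _]|/t0->]; last by rewrite mulr0.
  by case: noD; exists phi.
suff /choice[f fP] (i : 'I_n) : exists cphi : R[i] * Delta D,
    forall (s : Delta D -> R[i]) (t : Delta E -> R[i]),
    (forall phi', t (j phi') = s phi') ->
    (forall chi', (forall x, \val chi' (iota x) = 0) -> t chi' = 0) ->
    c i * t (chi i) = cphi.1 * s cphi.2.
  exists n, (fst \o f), (snd \o f) => s t ts t0.
  by apply: eq_bigr => i _; exact: fP.
case: (range_jP (chi i)) => [[phi _ <-]|chi0].
  by exists (c i, phi) => s t ts _; rewrite ts.
by exists (0, phi0) => s t _ t0; rewrite t0// mulr0 mul0r.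
Qed.

Context (sigma : Delta D -> R[i]^o) (tau : Delta E -> R[i]^o).
Hypothesis tau_j : forall phi, tau (j phi) = sigma phi.
Hypothesis tau0 : forall chi : Delta E,
  (forall x, \val chi (iota x) = 0) -> tau chi = 0.

Lemma extend_continuous : continuous sigma -> continuous tau.
Proof.
move=> cs chi U; case: (range_jP chi) => [[phi _ <-]|chi0].
  rewrite tau_j => /cs[_ [[W oW <-] Wphi WU]].
  have [_ _ _ [a phia]] := set_valP phi.
  (* Restriction along [iota] is a left inverse of [j]. It lands in the ambient pointwise space
     because a restricted character may be zero; hence the use of the ambient open set [W]. *)
  pose rho (psi : Delta E) : {ptws D -> R[i]^o} := fun x => \val psi (iota x).
  have rhoj psi : rho (j psi) = \val psi.
    by apply/funext => x; rewrite /rho jE iotaK.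
  have crho : continuous rho.
    apply: (@ptws_continuous _ D _ rho) => x; exact: Delta_eval_continuous.
  have : \forall psi \near j phi, W (rho psi).
    have := crho (j phi) W; rewrite rhoj; apply; exact: open_nbhs_nbhs.
  have : \forall psi \near j phi, \val psi (iota a) != 0.
    have /cvgr_neq0 := Delta_eval_continuous (iota a) (j phi).
    by apply; rewrite jE iotaK.
  apply: filterS2 => psi psia Wpsi /=.
  case: (range_jP psi) => [[phi' _ jphi']|/(_ a)/eqP]; last first.
    by rewrite (negPf psia).
  by rewrite -jphi' tau_j; apply: WU; rewrite -jphi' rhoj in Wpsi.
rewrite tau0// => /nbhs_singleton U0.
(* Every character in the range of [j] kills [x - iota (pr x)], while [chi] takes there the value
   [chi x], which is nonzero. So near [chi] no character lies in the range, and [tau] is 0. *)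
have [_ _ _ [x chix]] := set_valP chi.
have : \forall psi \near chi, \val psi (x - iota (pr x)) != 0.
  have /cvgr_neq0 := Delta_eval_continuous (x - iota (pr x)) chi.
  by apply; rewrite DeltaB chi0 subr0.
apply: (@filterS _ _ (nbhs_filter chi)) => psi psix /=.
case: (range_jP psi) => [[phi _ jphi]|/tau0-> //].
by move: psix; rewrite -jphi DeltaB !jE iotaK subrr eqxx.
Qed.

Lemma CBSE_extend : CBSE D sigma -> CBSE E tau.
Proof.
move=> [bs cs [M [b [bM b0 sM]]]]; split; last 1 first.
- exists (iota @` M), b; split=> //; first exact: tvs_bounded_image.
  (* [E'] is used twice: for [sigma] and [tau], then for the evaluations at [x] and [iota x], which
     makes the two dual seminorms equal. *)
  move=> n c chi; have [m [c' [phi E']]] := lincomb_pullback c chi.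
  rewrite (E' sigma)//; apply: le_trans (sM _ _ _) _.
  rewrite ler_pM2l// /dual_seminorm image_comp.
  rewrite le_eqVlt; apply/orP; left; apply/eqP; congr sup.
  apply: eq_imagel => x _ /=; congr normc.
  rewrite (E' (fun psi => \val psi x) (fun psi => \val psi (iota x)))//.
  by move=> psi; rewrite jE iotaK.
(* [K] need not be nonnegative when [Delta D] is empty, whereas [tau] may still take the value 0. *)
- move: bs => /bounded_funP[K KP]; apply/bounded_funP; exists `|K| => chi.
  case: (range_jP chi) => [[phi _ <-]|/tau0 E0].
    have K0 : 0 <= K := le_trans (normr_ge0 _) (KP phi).
    by rewrite /= tau_j (ger0_norm K0) KP.
  by rewrite /= E0 normr0.
- exact: extend_continuous.
Qed.

End Retract.

Theorem lemma2p2 (R : realType) (A B : comFrechetAlgType R) :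
  CBSE (A * B)%type = [set dsum_fun s | s in CBSE A `*` CBSE B].
Proof.
have fstL : linear (fst : A * B -> A) by [].
have sndL : linear (snd : A * B -> B) by [].
have inlL : linear (fun a : A => (a, 0) : A * B).
  by move=> c x y; congr (_, _); rewrite /= scaler0 addr0.
have inrL : linear (fun b : B => (0, b) : A * B).
  by move=> c x y; congr (_, _); rewrite /= scaler0 addr0.
have fstC : continuous (fst : A * B -> A) by move=> x; exact: cvg_fst.
have sndC : continuous (snd : A * B -> B) by move=> x; exact: cvg_snd.
have inlC : continuous (fun a : A => (a, 0) : A * B).
  by move=> x; apply: cvg_pair; [exact: cvg_id|exact: cvg_cst].
have inrC : continuous (fun b : B => (0, b) : A * B).
  by move=> x; apply: cvg_pair; [exact: cvg_cst|exact: cvg_id].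
have Delta0 (C : comFrechetAlgType R) (phi : Delta C) : \val phi 0 = 0.
  by rewrite -(subrr 0) DeltaB subrr.
apply/seteqP; split=> [sigma Bsigma|_ [[s1 s2] [/= B1 B2] <-]].
  exists (sigma \o @Delta_inl R A B, sigma \o @Delta_inr R A B).
    split; first by apply: (CBSE_restrict fstL fstC) Bsigma.
    by apply: (CBSE_restrict sndL sndC) Bsigma.
  apply/funext => chi; case: (Delta_dsumP chi) => [[phi ->]|[psi ->]].
    by rewrite dsum_fun_inl.
  by rewrite dsum_fun_inr.
have -> : dsum_fun (s1, s2) =
    (fun chi => dsum_fun (s1, fun=> 0) chi + dsum_fun (fun=> 0, s2) chi).
  apply/funext => chi; case: (Delta_dsumP chi) => [[phi ->]|[psi ->]].
    by rewrite !dsum_fun_inl addr0.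
  by rewrite !dsum_fun_inr add0r.
apply: CBSE_add.
  apply: (CBSE_extend (pr := fst) inlL inlC _ (@Delta_inl R A B)) B1 => //.
  + move=> chi; case: (Delta_dsumP chi) => [[phi ->]|[psi ->]].
      by left; exists phi.
    by right=> x; exact: Delta0.
  + by move=> phi; exact: dsum_fun_inl.
  (* A character coming from [A] cannot vanish on [A], being nonzero; on those coming from [B] the
     extension is 0 by construction. *)
  + move=> chi; case: (Delta_dsumP chi) => [[phi ->]|[psi ->] _].
      have [_ _ _ [x /negP phix]] := set_valP phi.
      by move=> /(_ x)/eqP.
    by rewrite dsum_fun_inr.
apply: (CBSE_extend (pr := snd) inrL inrC _ (@Delta_inr R A B)) B2 => //.
+ move=> chi; case: (Delta_dsumP chi) => [[phi ->]|[psi ->]].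
    by right=> x; exact: Delta0.
  by left; exists psi.
+ by move=> psi; exact: dsum_fun_inr.
+ move=> chi; case: (Delta_dsumP chi) => [[phi ->] _|[psi ->]].
    by rewrite dsum_fun_inl.
  have [_ _ _ [x /negP psix]] := set_valP psi.
  by move=> /(_ x)/eqP.
Qed.
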